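(* Assume: (i) $\mathbf V$ has rank $N_p$, and $\mathbf W$ and all $\mathbf W^{(\gamma)}$, $\gamma\in\{1,\dots,N_f\}$, are symmetric positive definite; (ii) $\mathbf M^{(\kappa)}$ is invertible for all $\kappa\in\{1,\dots,K\}$; (iii) $\mathcal{M}$ is chosen such that $\mathbf K\mathbf D^{(m)}=\mathbf 0$ for all $m\in\{1,\dots,d\}$, and the coefficients $C(\alpha)$ are chosen such that $\mathbf M+\mathbf K$ is symmetric positive definite; (iv) $\mathcal{V}$ contains the constant functions. Let $\mathbf F:=(\mathbf I+\mathbf M^{-1}\mathbf K)^{-1}$ and $\mathbf F^{(\kappa)}:=(\mathbf P\mathbf J^{(\kappa)}\mathbf V)^{-1}\mathbf F(\mathbf P\mathbf J^{(\kappa)}\mathbf V)$. Let $u^{(h,\kappa,e)}(t)$ satisfy either the weak-form discontinuous Galerkin (DG) method $$\mathbf M^{(\kappa)}\frac{d u^{(h,\kappa,e)}}{dt}-\sum_{m=1}^d(\mathbf D^{(m)})^T\mathbf V^T\mathbf W f^{(h,\kappa,m,e)}+\sum_{\gamma=1}^{N_f}(\mathbf V^{(\gamma)})^T\mathbf W^{(\gamma)}f^{( *,\kappa,\gamma,e)}=0$$ or the filtered weak-form DG method obtained from it by replacing $\mathbf M^{(\kappa)}$ with $\mathbf M^{(\kappa)}(\mathbf F^{(\kappa)})^{-1}$, for all $\kappa\in\{1,\dots,K\}$, $e\in\{1,\dots,N_{\rm Eq}\}$, $t\in(0,T)$. Then the method is locally conservative: $$\frac{d}{dt}\Big(\mathbf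 1^T\mathbf W\mathbf J^{(\kappa)}\mathbf V u^{(h,\kappa,e)}(t)\Big)+\sum_{\gamma=1}^{N_f}\mathbf 1^T\mathbf W^{(\gamma)}f^{( *,\kappa,\gamma,e)}(t)=0$$ for all $\kappa\in\{1,\dots,K\}$, $e\in\{1,\dots,N_{\rm Eq}\}$, $t\in(0,T)$. Moreover, if the numerical flux satisfies $F^*(U,V,n)=-F^*(V,U,-n)$ for all $U,V\in\Upsilon$ and $n\in\mathbb{S}^{d-1}$, and the mesh satisfies the conformity assumption described in the context, then the method is globally conservative: $$\frac{d}{dt}\Big(\sum_{\kappa=1}^K\mathbf 1^T\mathbf W\mathbf J^{(\kappa)}\mathbf V u^{(h,\kappa,e)}(t)\Big)+\sum_{(\kappa,\gamma)\in\mathcal{K}_{\partial\Omega}}\mathbf 1^T\mathbf W^{(\gamma)}f^{( *,\kappa,\gamma,e)}(t)=0$$ for all $e\in\{1,\dots,N_{\rm Eq}\}$ and $t\in(0,T)$.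
   Context: Reference element and operators. $\hat\Omega\subset\mathbb{R}^d$ is a polytope with volume $|\hat\Omega|$, flat facets $\hat\Gamma^{(\gamma)}$, $\gamma\in\{1,\dots,N_f\}$, and outward unit normals $\hat n^{(\gamma)}$. $\mathcal{V}$ is the space of real polynomial functions on $\hat\Omega$ spanned by the monomials $\hat x_1^{\alpha_1}\cdots\hat x_d^{\alpha_d}$ with exponents in a finite set $\mathcal{N}\supseteq\{\alpha\in\mathbb{N}_0^d:|\alpha|\le p\}$ of $N_p$ multi-indices, where $|\alpha|=\alpha_1+\dots+\alpha_d$ and $p\in\mathbb{N}_0$; $\mathcal{V}$ is assumed closed under each $\partial/\partial\hat x_m$. $\{\phi^{(i)}\}_{i=1}^{N_p}$ is an arbitrary basis of $\mathcal{V}$. Volume nodes $\hat x^{(i)}\in\hat\Omega$, $i\in\{1,\dots,N\}$ ($N\ge N_p$), facet nodes $\hat x^{(\gamma,i)}\in\hat\Gamma^{(\gamma)}$, $i\in\{1,\dots,N_\gamma\}$, and matrices $\mathbf W\in\mathbb{R}^{N\times N}$, $\mathbf W^{(\gamma)}\in\mathbb{R}^{N_\gamma\times N_\gamma}$ are given. Set $V_{ij}:=\phi^{(j)}(\hat x^{(i)})$, $V^{(\gamma)}_{ij}:=\phi^{(j)}(\hat x^{(\gamma,i)})$, $\mathbf M:=\mathbf V^T\mathbf W\mathbf V$, $\mathbf P:=\mathbf M^{-1}\mathbf V^T\mathbf W$, and define $\mathbf D^{(m)}$ by $\partial\phi^{(j)}/\partial\hat x_m=\sum_iD^{(m)}_{ij}\phi^{(i)}$.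 For a finite set $\mathcal{M}\subset\mathcal{N}$ and $C:\mathcal{M}\to\mathbb{R}$, $\mathbf K:=\sum_{\alpha\in\mathcal{M}}\frac{C(\alpha)}{|\hat\Omega|}(\mathbf D^{(\alpha)})^T\mathbf M\mathbf D^{(\alpha)}$ with $\mathbf D^{(\alpha)}:=(\mathbf D^{(1)})^{\alpha_1}\cdots(\mathbf D^{(d)})^{\alpha_d}$. $\mathbf I$ is the identity matrix and $\mathbf 1$ is a vector of ones of the appropriate length. Mesh. $\bar\Omega\subset\mathbb{R}^d$ is the union of compact elements $\Omega^{(\kappa)}$, $\kappa\in\{1,\dots,K\}$, with disjoint interiors, each the image of $\hat\Omega$ under a smooth bijective time-independent map $X^{(\kappa)}$ with Jacobian matrix $\boldsymbol{\mathcal J}^{(\kappa)}$ and $\mathcal J^{(\kappa)}:=\det\boldsymbol{\mathcal J}^{(\kappa)}>0$; $\Gamma^{(\kappa,\gamma)}:=X^{(\kappa)}(\hat\Gamma^{(\gamma)})$ is a smooth facet with outward unit normal $n^{(\kappa,\gamma)}$, and $\mathcal J^{(\kappa,\gamma)}(\hat x):=\|\mathcal J^{(\kappa)}(\hat x)(\boldsymbol{\mathcal J}^{(\kappa)}(\hat x))^{-T}\hat n^{(\gamma)}\|_2$. $\mathbf J^{(\kappa)}:=\mathrm{diag}(\mathcal J^{(\kappa)}(\hat x^{(1)}),\dots,\mathcal J^{(\kappa)}(\hat x^{(N)}))$, $\mathbf J^{(\kappa,\gamma)}:=\mathrm{diag}(\mathcal J^{(\kappa,\gamma)}(\hat x^{(\gamma,1)}),\dots,\mathcal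 J^{(\kappa,\gamma)}(\hat x^{(\gamma,N_\gamma)}))$ and $\mathbf M^{(\kappa)}:=\mathbf V^T\mathbf W\mathbf J^{(\kappa)}\mathbf V$. Periodic boundaries are treated identically to interior interfaces; $\partial\Omega$ denotes only the non-periodic part of the boundary. $\mathcal{K}_{\partial\Omega}$ is the set of pairs $(\kappa,\gamma)\in\{1,\dots,K\}\times\{1,\dots,N_f\}$ with $\Gamma^{(\kappa,\gamma)}\subset\partial\Omega$, and $\mathcal{K}_\Omega$ is the set of all other pairs, corresponding to facets forming interior or periodic interfaces. Conformity assumption. For each pair of element indices $\kappa,\nu\in\{1,\dots,K\}$ with $\kappa\ne\nu$ such that $\partial\Omega^{(\kappa)}\cap\partial\Omega^{(\nu)}\ne\emptyset$, there exist facet indices $\gamma,\eta\in\{1,\dots,N_f\}$ such that either $\Gamma^{(\kappa,\gamma)}=\Gamma^{(\nu,\eta)}$, or the facets are connected via periodic boundary conditions, in which case $\Gamma^{(\nu,\eta)}$ is the image of $\Gamma^{(\kappa,\gamma)}$ under a pure translation, with opposite orientation in the sense that $n^{(\nu,\eta)}=-n^{(\kappa,\gamma)}$. Moreover, for such corresponding facets, $N_\eta=N_\gamma$ and there is a permutation $\tau^{(\kappa,\gamma)}$ of $\{1,\dots,N_\gamma\}$ such that $X^{(\kappa)}(\hat x^{(\gamma,i)})=X^{(\nu)}(\hat x^{(\eta,\tau^{(\kappa,\gamma)}(i))})$ for all $i\in\{1,\dots,N_\gamma\}$, with an additional translation in the periodic case. With $\mathbf T^{(\kappa,\gamma)}$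 the permutation matrix whose $i$-th row is the $\tau^{(\kappa,\gamma)}(i)$-th standard basis vector of $\mathbb{R}^{N_\gamma}$, it is assumed that $\mathbf W^{(\eta)}\mathbf J^{(\nu,\eta)}=(\mathbf T^{(\kappa,\gamma)})^T\mathbf W^{(\gamma)}\mathbf J^{(\kappa,\gamma)}\mathbf T^{(\kappa,\gamma)}$. Semi-discrete quantities. The conservation law is $\partial_tU+\sum_{m=1}^d\partial_{x_m}F^{(m)}(U)=0$ with $U\in\Upsilon\subseteq\mathbb{R}^{N_{\rm Eq}}$ and $F^{(m)}:\Upsilon\to\mathbb{R}^{N_{\rm Eq}}$. The unknown vectors $u^{(h,\kappa,e)}(t)\in\mathbb{R}^{N_p}$ define $U^{(h,\kappa)}_e(\hat x,t)=\sum_iu^{(h,\kappa,e)}_i(t)\phi^{(i)}(\hat x)$, and $U^{(h,\kappa)}$ is assumed to take values in $\Upsilon$. The vector $f^{(h,\kappa,m,e)}(t)\in\mathbb{R}^N$ has entries equal to the $e$-th component of $\sum_{n=1}^d\mathcal J^{(\kappa)}[(\boldsymbol{\mathcal J}^{(\kappa)})^{-1}]_{mn}F^{(n)}(U^{(h,\kappa)})$ at the nodes $\hat x^{(i)}$; the vector $f^{( *,\kappa,\gamma,e)}(t)\in\mathbb{R}^{N_\gamma}$ has entries equal to the $e$-th component of $\mathcal J^{(\kappa,\gamma)}F^*(U^{(h,\kappa)},U^{(+,\kappa,\gamma)},n^{(\kappa,\gamma)}\circ X^{(\kappa)})$ at the nodes $\hat x^{(\gamma,i)}$, where $F^*:\Upsilon\times\Upsilon\times\mathbb{S}^{d-1}\to\mathbb{R}^{N_{\rm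 Eq}}$ is a numerical flux function and $\mathbb{S}^{d-1}$ is the unit sphere in $\mathbb{R}^d$. $U^{(+,\kappa,\gamma)}$ is the external data of a weakly imposed boundary or interface condition: for $(\kappa,\gamma)\in\mathcal{K}_\Omega$ whose coincident or periodically connected facet is $(\nu,\eta)\in\mathcal{K}_\Omega$, its value at $\hat x^{(\gamma,i)}$ is $U^{(h,\nu)}(\hat x^{(\eta,\tau^{(\kappa,\gamma)}(i))},t)$; for $(\kappa,\gamma)\in\mathcal{K}_{\partial\Omega}$ it is boundary data.
   Formalization: For the filtered method, if 𝒩 contains only the zero multi-index (𝒱 is just the constants), K = 0 is additionally assumed; otherwise ℳ = {0}, C(0) > 0 gives K = cM, and local conservation fails by a factor 1 + c. *)

(* Defs.v *)
From mathcomp Require Import all_boot all_order all_fingroup all_algebra finmap.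
From mathcomp Require Import all_classical all_reals all_analysis.

Set Implicit Arguments.
Unset Strict Implicit.
Unset Printing Implicit Defensive.

Import Order.TTheory GRing.Theory Num.Theory.
Import numFieldNormedType.Exports.

Local Open Scope classical_set_scope.
Local Open Scope ring_scope.

(* Points of R^d are row vectors.  The library norm `|x| on matrices is the
   max norm, so the Euclidean norm is defined separately. *)
Definition dot (R : realType) (d : nat) (x y : 'rV[R]_d) : R :=
  (x *m y^T) ord0 ord0.

Definition enorm (R : realType) (d : nat) (x : 'rV[R]_d) : R :=
  Num.sqrt (dot x x).

Definition sphere (R : realType) (d : nat) : set 'rV[R]_d :=
  [set x | enorm x = 1].

Definition frontier (T : topologicalType) (A : set T) : set T :=
  closure A `\` interior A.

Definition spd (R : realType) (n : nat) (A : 'M[R]_n) : Prop :=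
  A^T = A /\
  forall x : 'cV[R]_n, x != 0 -> 0 < (x^T *m A *m x) ord0 ord0.

Definition ones (R : realType) (n : nat) : 'cV[R]_n := const_mx 1.

Definition box_vol (R : realType) (d : nat) (a b : 'rV[R]_d) : R :=
  \prod_(i < d) Num.max 0 (b ord0 i - a ord0 i).

(* d-dimensional Lebesgue (outer) measure, by countable covers by boxes. *)
Definition volume (R : realType) (d : nat) (A : set 'rV[R]_d) : R :=
  fine (ereal_inf [set s : \bar R | exists a b : nat -> 'rV[R]_d,
    A `<=` \bigcup_k [set x | forall i : 'I_d,
                        a k ord0 i <= x ord0 i <= b k ord0 i] /\
    s = (\sum_(0 <= k <oo) (box_vol (a k) (b k))%:E)%E]).

Definition partial (R : realType) (d : nat) (V : normedModType R) (m : 'I_d)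
    (f : 'rV[R]_d -> V) : 'rV[R]_d -> V :=
  fun x => 'D_(delta_mx ord0 m) f x.

(* C^infinity on an open neighbourhood of A: all iterated partial derivatives
   exist there and are differentiable. *)
Definition smooth_on (R : realType) (d : nat) (V : normedModType R)
    (A : set 'rV[R]_d) (f : 'rV[R]_d -> V) : Prop :=
  exists U : set 'rV[R]_d, [/\ open U, A `<=` U &
    forall (s : seq 'I_d) x, U x ->
      differentiable (foldr (fun m g => partial m g) f s) x].

(* Convex polytope { x | forall g, nhat g . x <= b g } with nonempty interior; the
   last field makes the description irredundant, so that the facets are exactly
   the sets cut out by the equalities nhat g . x = b g. *)
Record ref_element (R : realType) (d : nat) := RefElement {
  Nf : nat;
  nhat : 'I_Nf -> 'rV[R]_d;
  bhat : 'I_Nf -> R;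
  Omega_hat : set 'rV[R]_d := [set x | forall g, dot (nhat g) x <= bhat g];
  nhat_unit : forall g, sphere (nhat g);
  Omega_hat_compact : compact Omega_hat;
  Omega_hat_full : exists x, forall g, dot (nhat g) x < bhat g;
  Gamma_hat_facet : forall g, exists2 x, dot (nhat g) x = bhat g &
    forall h, h != g -> dot (nhat h) x < bhat h }.

Definition Gamma_hat (R : realType) (d : nat) (E : ref_element R d)
    (g : 'I_(Nf E)) : set 'rV[R]_d :=
  [set x | Omega_hat E x /\ dot (nhat g) x = bhat g].

Notation multiindex d := {ffun 'I_d -> nat}.

(* Since Omega_hat has nonempty interior, polynomial functions on it are
   identified with polynomial functions on R^d. *)
Definition poly_space (R : realType) (d : nat) (A : {fset multiindex d}) :
    set ('rV[R]_d -> R) :=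
  [set f : 'rV[R]_d -> R | exists c : multiindex d -> R, forall x,
    f x = \sum_(a <- A) c a * \prod_(i < d) x ord0 i ^+ a i].

Record discretization (R : realType) (d : nat) (E : ref_element R d) :=
  Discretization {
  pdeg : nat;
  calN : {fset multiindex d};
  calN_deg : forall a : multiindex d,
    (\sum_(i < d) a i <= pdeg)%N -> a \in calN;
  poly_space_deriv : forall (f : 'rV[R]_d -> R) (m : 'I_d),
    poly_space calN f -> poly_space calN (partial m f);
  Np : nat;
  Np_card : Np = #|` calN|;
  phi : 'I_Np -> 'rV[R]_d -> R;
  phi_poly : forall i, poly_space calN (phi i);
  phi_free : forall c : 'I_Np -> R,
    (forall x, \sum_i c i * phi i x = 0) -> forall i, c i = 0;
  phi_span : forall f : 'rV[R]_d -> R, poly_space calN f ->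
    exists c : 'I_Np -> R, forall x, f x = \sum_i c i * phi i x;
  Nv : nat;
  Nv_ge : (Np <= Nv)%N;
  xv : 'I_Nv -> 'rV[R]_d;
  xv_in : forall i, Omega_hat E (xv i);
  Nq : 'I_(Nf E) -> nat;
  xf : forall g, 'I_(Nq g) -> 'rV[R]_d;
  xf_in : forall g (i : 'I_(Nq g)), Gamma_hat g (xf i);
  Wv : 'M[R]_Nv;
  Wf : forall g, 'M[R]_(Nq g);
  Dmx : 'I_d -> 'M[R]_Np;
  DmxE : forall m j x,
    partial m (phi j) x = \sum_i Dmx m i j * phi i x }.

Section Operators.
Variables (R : realType) (d : nat) (E : ref_element R d).
Variable S : discretization E.

Definition Vmx : 'M[R]_(Nv S, Np S) := \matrix_(i, j) phi j (xv i).

Definition Vfmx (g : 'I_(Nf E)) : 'M[R]_(Nq S g, Np S) :=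
  \matrix_(i, j) phi j (xf i).

Definition Mmx : 'M[R]_(Np S) := Vmx^T *m Wv S *m Vmx.

Definition Pmx : 'M[R]_(Np S, Nv S) := invmx Mmx *m Vmx^T *m Wv S.

Definition Dpow (a : multiindex d) : 'M[R]_(Np S) :=
  \prod_(m < d) (Dmx S m ^+ a m).

Definition Kmx (Ms : {fset multiindex d}) (C : multiindex d -> R) :
    'M[R]_(Np S) :=
  \sum_(a <- Ms) (C a / volume (Omega_hat E)) *:
    ((Dpow a)^T *m Mmx *m Dpow a).

Definition Fmx (Ms : {fset multiindex d}) (C : multiindex d -> R) :
    'M[R]_(Np S) :=
  invmx (1%:M + invmx Mmx *m Kmx Ms C).

End Operators.

(* [n] is the outward unit normal field of the facet [G] of the element [A],
   where [G'] is the union of the other facets: it is continuous on [G], to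
   first order [G] is orthogonal to it at each point, and at the points of [G]
   lying on no other facet it points out of [A].  At edges and corners its
   orientation is determined by continuity. *)
Definition outward_unit_normal (R : realType) (d : nat)
    (A G G' : set 'rV[R]_d) (n : 'rV[R]_d -> 'rV[R]_d) : Prop :=
  [/\ {within G, continuous n},
      forall x, G x -> sphere (n x),
      forall x, G x -> forall eps : R, 0 < eps ->
        \forall y \near x, G y -> `|dot (n x) (y - x)| <= eps * `|y - x|
    & forall x, G x -> ~ G' x -> \forall t \near (0 : R)^'+,
        interior A (x - t *: n x) /\ ~ A (x + t *: n x)].

(* Entry (m, n) is the derivative of the m-th component in direction n; the
   library's ['J X x] acts on row vectors and is the transpose of this. *)
Definition jacmx (R : realType) (d : nat) (X : 'rV[R]_d -> 'rV[R]_d)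
    (x : 'rV[R]_d) : 'M[R]_d :=
  ('J X x)^T.

(* [periodic] lists the facets on which periodic conditions are imposed. *)
Record mesh (R : realType) (d : nat) (E : ref_element R d) := Mesh {
  nelt : nat;
  Xmap : 'I_nelt -> 'rV[R]_d -> 'rV[R]_d;
  Xmap_smooth : forall k, smooth_on (Omega_hat E) (Xmap k);
  Xmap_inj : forall k, set_inj (Omega_hat E) (Xmap k);
  Xmap_det : forall k x, Omega_hat E x -> 0 < \det (jacmx (Xmap k) x);
  elt : 'I_nelt -> set 'rV[R]_d := fun k => Xmap k @` Omega_hat E;
  elt_disjoint : forall k l, k != l ->
    interior (elt k) `&` interior (elt l) = set0;
  facet : 'I_nelt * 'I_(Nf E) -> set 'rV[R]_d :=
    fun q => Xmap q.1 @` Gamma_hat q.2;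
  normal : 'I_nelt * 'I_(Nf E) -> 'rV[R]_d -> 'rV[R]_d;
  normalP : forall q, outward_unit_normal (elt q.1) (facet q)
    (\bigcup_(g in [set g | g != q.2]) facet (q.1, g)) (normal q);
  periodic : {set 'I_nelt * 'I_(Nf E)} }.

Section MeshOperators.
Variables (R : realType) (d : nat) (E : ref_element R d).
Variables (S : discretization E) (Me : mesh E).

Definition domain : set 'rV[R]_d := \bigcup_k elt (m := Me) k.

(* The non-periodic part of the boundary.  The closure puts back the points
   that periodic facets share with non-periodic ones. *)
Definition bdry : set 'rV[R]_d :=
  closure (frontier domain `\`
    \bigcup_(q in [set q | q \in periodic Me]) facet (m := Me) q).

Definition Kbdry : {set 'I_(nelt Me) * 'I_(Nf E)} :=
  [set q | `[< facet (m := Me) q `<=` bdry >]]%SET.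

Definition Kint : {set 'I_(nelt Me) * 'I_(Nf E)} := (~: Kbdry)%SET.

Definition jac (k : 'I_(nelt Me)) (x : 'rV[R]_d) : R :=
  \det (jacmx (Xmap k) x).

(* The row vector [nhat *m J^-1] is the transpose of [J^-T *m nhat^T]. *)
Definition jacf (q : 'I_(nelt Me) * 'I_(Nf E)) (x : 'rV[R]_d) : R :=
  enorm (jac q.1 x *: (nhat q.2 *m invmx (jacmx (Xmap q.1) x))).

Definition Jmx (k : 'I_(nelt Me)) : 'M[R]_(Nv S) :=
  diag_mx (\row_i jac k (xv i)).

Definition Jfmx (q : 'I_(nelt Me) * 'I_(Nf E)) : 'M[R]_(Nq S q.2) :=
  diag_mx (\row_i jacf q (xf i)).

Definition Mkmx (k : 'I_(nelt Me)) : 'M[R]_(Np S) :=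
  (Vmx S)^T *m Wv S *m Jmx k *m Vmx S.

Definition Fkmx (Ms : {fset multiindex d}) (C : multiindex d -> R)
    (k : 'I_(nelt Me)) : 'M[R]_(Np S) :=
  let Q := Pmx S *m Jmx k *m Vmx S in
  invmx Q *m Fmx S Ms C *m Q.

(* Witnesses that the mesh is conforming: [nbr] maps each interior or periodic
   facet to the facet it coincides with or is periodically connected to,
   [shift] is the corresponding translation (zero for coincident facets) and
   [tau] is the permutation matching the nodes.  Row i of [perm_mx s] is the
   (s i)-th standard basis vector. *)
Record conformity := Conformity {
  nbr : 'I_(nelt Me) * 'I_(Nf E) -> 'I_(nelt Me) * 'I_(Nf E);
  shift : 'I_(nelt Me) * 'I_(Nf E) -> 'rV[R]_d;
  tau : forall q : 'I_(nelt Me) * 'I_(Nf E), 'S_(Nq S q.2);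
  nbr_pairing : forall q, q \in Kint ->
    [/\ nbr q \in Kint, nbr q != q & nbr (nbr q) = q];
  nbr_touching : forall k l, k != l ->
    frontier (elt (m := Me) k) `&` frontier (elt (m := Me) l) !=set0 ->
    exists g h, (k, g) \in Kint /\ nbr (k, g) = (l, h);
  nbr_coincident : forall q, q \in Kint -> q \notin periodic Me ->
    facet (m := Me) (nbr q) = facet (m := Me) q /\ shift q = 0;
  nbr_periodic : forall q, q \in Kint -> q \in periodic Me ->
    [/\ nbr q \in periodic Me,
        facet (m := Me) (nbr q) =
          [set x + shift q | x in facet (m := Me) q]
      & forall x, facet (m := Me) q x ->
          normal (nbr q) (x + shift q) = - normal q x];
  nbr_Nq : forall q, q \in Kint -> Nq S (nbr q).2 = Nq S q.2;
  nbr_node : forall q, q \in Kint -> 'I_(Nq S q.2) -> 'I_(Nq S (nbr q).2) :=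
    fun q qK i => cast_ord (esym (nbr_Nq qK)) (tau q i);
  nbr_nodeP : forall q (qK : q \in Kint) (i : 'I_(Nq S q.2)),
    Xmap q.1 (xf i) + shift q = Xmap (nbr q).1 (xf (nbr_node qK i));
  nbr_weights : forall q (qK : q \in Kint),
    castmx (nbr_Nq qK, nbr_Nq qK) (Wf S (nbr q).2 *m Jfmx (nbr q)) =
    (perm_mx (tau q))^T *m (Wf S q.2 *m Jfmx q) *m perm_mx (tau q) }.

End MeshOperators.

Section SemiDiscrete.
Variables (R : realType) (d Neq : nat) (E : ref_element R d).
Variables (S : discretization E) (Me : mesh E).
Variable F : 'I_d -> 'rV[R]_Neq -> 'rV[R]_Neq.
Variable Fstar : 'rV[R]_Neq -> 'rV[R]_Neq -> 'rV[R]_d -> 'rV[R]_Neq.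
Variable u : 'I_(nelt Me) -> 'I_Neq -> R -> 'cV[R]_(Np S).
Variable Uext : forall q : 'I_(nelt Me) * 'I_(Nf E),
  'I_(Nq S q.2) -> R -> 'rV[R]_Neq.

Definition Uh (k : 'I_(nelt Me)) (x : 'rV[R]_d) (t : R) : 'rV[R]_Neq :=
  \row_e \sum_i u k e t i ord0 * phi i x.

Definition fvol (k : 'I_(nelt Me)) (m : 'I_d) (e : 'I_Neq) (t : R) :
    'cV[R]_(Nv S) :=
  \col_i \sum_(n < d)
    (jac k (xv i) * invmx (jacmx (Xmap k) (xv i)) m n *
     F n (Uh k (xv i) t) ord0 e).

Definition fstar (k : 'I_(nelt Me)) (g : 'I_(Nf E)) (e : 'I_Neq) (t : R) :
    'cV[R]_(Nq S g) :=
  \col_i (jacf (k, g) (xf i) *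
    Fstar (Uh k (xf i) t) (@Uext (k, g) i t)
      (normal (k, g) (Xmap k (xf i))) ord0 e).

(* The weak-form method with mass matrices [A k]. *)
Definition dg_method (A : 'I_(nelt Me) -> 'M[R]_(Np S)) (T : R) : Prop :=
  forall (k : 'I_(nelt Me)) (e : 'I_Neq) (t : R), 0 < t < T ->
    derivable (u k e) t 1 /\
    A k *m derive1 (u k e) t
    - \sum_(m < d) (Dmx S m)^T *m (Vmx S)^T *m Wv S *m fvol k m e t
    + \sum_(g < Nf E) (Vfmx S g)^T *m Wf S g *m fstar k g e t = 0.

Definition cell_total (k : 'I_(nelt Me)) (e : 'I_Neq) (t : R) : R :=
  ((ones R (Nv S))^T *m Wv S *m Jmx S k *m Vmx S *m u k e t) ord0 ord0.

Definition facet_flux (q : 'I_(nelt Me) * 'I_(Nf E)) (e : 'I_Neq) (t : R) :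
    R :=
  ((ones R (Nq S q.2))^T *m Wf S q.2 *m fstar q.1 q.2 e t) ord0 ord0.

Definition locally_conservative (T : R) : Prop :=
  forall (k : 'I_(nelt Me)) (e : 'I_Neq) (t : R), 0 < t < T ->
    derivable (cell_total k e) t 1 /\
    derive1 (cell_total k e) t + \sum_(g < Nf E) facet_flux (k, g) e t = 0.

Definition globally_conservative (T : R) : Prop :=
  forall (e : 'I_Neq) (t : R), 0 < t < T ->
    derivable (fun s => \sum_k cell_total k e s) t 1 /\
    derive1 (fun s => \sum_k cell_total k e s) t
    + \sum_(q in Kbdry Me) facet_flux q e t = 0.

End SemiDiscrete.

(* Main.v *)
Require Import Defs.
From mathcomp Require Import all_boot all_order all_fingroup all_algebra finmap.
From mathcomp Require Import all_classical all_reals all_analysis.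
From mathcomp Require Import ring lra.
Import Order.TTheory GRing.Theory Num.Theory.
Import numFieldNormedType.Exports.
Local Open Scope classical_set_scope.
Local Open Scope ring_scope.

Set Implicit Arguments.
Unset Strict Implicit.
Unset Printing Implicit Defensive.

(** Let [b] be the column of coefficients of the constant function [1] in the
    basis [phi].  Multiplying the method by [b^T] proves local conservation:
    [Vmx *m b] and [Vfmx g *m b] are vectors of ones, so the mass and facet terms
    become the rate of change of the cell total and the facet fluxes, and the
    volume term vanishes because [Dmx m *m b] is the derivative of a constant
    ([dg_locally_conservative]).

    Filtering adds to the mass matrix a term of the form [K *m _]
    ([filtered_mass]), and [b^T *m K = 0] ([Kmx_represents_cst]): by hypothesis
    the symmetric matrix [K] vanishes on all derivatives, and a nonzero constant
    is the derivative of some element of the polynomial space, unless the space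
    contains only constants, in which case [K = 0].

    Summing over the elements leaves the fluxes through all facets, and the
    interior ones cancel in pairs ([facet_flux_nbr], [interior_flux_eq0]).  For
    this the external data at a node of the neighbouring facet has to be the
    trace of the element one started from, and the two normals have to be
    opposite.  The first point holds because the two translations of a pair of
    facets are inverse to each other, a bounded set having no translation into
    itself but the identity ([shift_nbr]), and because the element maps are
    injective.  The second point is geometry for facets that coincide
    ([normals_opposite]).  At a point in the relative interior of the facet, both
    normals are orthogonal to the same tangent hyperplane, hence equal up to
    sign; equal normals would make the two elements overlap.  Such points are
    dense in the facet and the normals are continuous on it. *)

(** * Derivatives of polynomials *)

Definition monomial {R : realType} {d : nat} (a : multiindex d)
    (x : 'rV[R]_d) : R :=
  \prod_(i < d) x ord0 i ^+ a i.

Definition decr {d : nat} (a : multiindex d) (m : 'I_d) : multiindex d :=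
  [ffun i => if i == m then (a i).-1 else a i].

Lemma is_derive_line {R : realType} {V W : normedModType R} (f : V -> W)
    (x v : V) (df : W) :
  is_derive (0 : R) 1 (fun h : R => f (h *: v + x)) df -> is_derive x v f df.
Proof.
case=> D Df; apply: DeriveDef; first by apply/(derivable1P f x v).
rewrite -Df /derive; set q1 := fun h => h^-1 *: _; set q2 := fun h => h^-1 *: _.
suff -> : q1 = q2 by [].
by apply/funext => h; rewrite /q1 /q2 /= addr0 scale0r add0r [_%:A]mulr1.
Qed.

Lemma is_derive_monomial {R : realType} {d : nat} (a : multiindex d)
    (m : 'I_d) (x : 'rV[R]_d) :
  is_derive x (delta_mx ord0 m) (monomial a)
    ((a m)%:R * monomial (decr a m) x).
Proof.
apply: is_derive_line.
set c := \prod_(i < d | i != m) x ord0 i ^+ a i.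
have -> : (fun h : R => monomial a (h *: delta_mx ord0 m + x)) =
    c \*: (id + cst (x ord0 m)) ^+ a m.
  apply/funext => h; rewrite /monomial (bigD1 m) //= mulrC !mxE !eqxx mulr1.
  rewrite fctE; congr (_ * _); apply: eq_bigr => i /negPf im.
  by rewrite !mxE im !mulr0 add0r.
apply: is_derive_eq.
rewrite /= !fctE add0r addr0 /monomial [X in _ = _ * X](bigD1 m) //= ffunE eqxx.
rewrite [_%:A]mulr1 -[LHS]/(c * _) mulrCA [c * _]mulrC.
congr (_ * (_ * _)); apply: eq_bigr => i /negPf im.
by rewrite ffunE im.
Qed.

Lemma poly_space_derivable {R : realType} {d : nat} (A : {fset multiindex d})
    (f : 'rV[R]_d -> R) (m : 'I_d) (x : 'rV[R]_d) :
  poly_space A f -> derivable f x (delta_mx ord0 m).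
Proof.
case=> c fE.
have -> : f = \sum_(a <- A) c a \*: monomial a.
  by apply/funext => y; rewrite fE fct_sumE.
elim/big_ind: _ => [|g h|a _]; first exact: derivable_cst.
  exact: derivableD.
by apply: derivableZ; have [] := is_derive_monomial a m x.
Qed.

Lemma poly_space_monomial {R : realType} {d : nat} (A : {fset multiindex d})
    (a : multiindex d) : a \in A -> poly_space A (monomial a : 'rV[R]_d -> R).
Proof.
move=> aA; exists (fun b => (b == a)%:R) => x.
rewrite (big_fsetD1 a) //= eqxx mul1r -/(monomial a x) big_seq_cond big1 ?addr0 //.
by move=> b; rewrite !inE andbT => /andP[/negPf -> _]; rewrite mul0r.
Qed.

(** Differentiating a nonconstant monomial lowers its degree by one, so in a
    space closed under differentiation the constants are reached, and the last
    step exhibits a nonzero constant as a derivative. *)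
Lemma const_is_partial {R : realType} {d : nat} (A : {fset multiindex d})
    (a : multiindex d) :
  (forall (f : 'rV[R]_d -> R) m, poly_space A f -> poly_space A (partial m f)) ->
  a \in A -> a != [ffun=> 0%N] ->
  exists (f : 'rV[R]_d -> R) (m : 'I_d) (c : R),
    [/\ poly_space A f, c != 0 & forall x, partial m f x = c].
Proof.
move=> closed aA a0.
have pick (b : multiindex d) n : \sum_i b i = n.+1 -> exists m, (0 < b m)%N.
  move=> bn; apply/existsP; rewrite -[X in is_true X]negbK negb_exists.
  apply/negP => /forallP b0; suff : n.+1 = 0 by [].
  by rewrite -bn big1 // => i _; have := b0 i; rewrite lt0n negbK => /eqP.
have decrE (b : multiindex d) m n : \sum_i b i = n.+1 -> (0 < b m)%N ->
    \sum_i decr b m i = n.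
  rewrite (bigD1 m) //= => bn bm; rewrite (bigD1 m) //= ffunE eqxx.
  rewrite (eq_bigr (fun i => b i)); last by move=> i /negPf im; rewrite ffunE im.
  by case: (b m) bm bn => //= k _ [].
have partialE (b : multiindex d) (k : R) m :
    partial m (fun x => k * monomial b x) =
    (fun x => k * (b m)%:R * monomial (decr b m) x).
  apply/funext => x; rewrite -mulrA /partial.
  have dm := is_derive_monomial b m x.
  exact: (@derive_val _ _ _ _ _ (k \*: monomial b)).
have descent n : forall (b : multiindex d) (k : R), \sum_i b i = n.+1 ->
    k != 0 -> poly_space A (fun x => k * monomial b x) ->
    exists (f : 'rV[R]_d -> R) (m : 'I_d) (c : R),
      [/\ poly_space A f, c != 0 & forall x, partial m f x = c].
  elim: n => [|n IH] b k bn k0 Ab; have [m bm] := pick _ _ bn.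
    exists (fun x => k * monomial b x), m, (k * (b m)%:R); split=> //.
      by rewrite mulf_neq0 // pnatr_eq0 -lt0n.
    move=> x; rewrite partialE /monomial big1 ?mulr1 // => i _.
    have /eqP := decrE _ _ _ bn bm.
    by rewrite sum_nat_eq0 => /forall_inP /(_ i isT) /eqP ->; rewrite expr0.
  apply: (IH (decr b m) (k * (b m)%:R)); first exact: decrE.
    by rewrite mulf_neq0 // pnatr_eq0 -lt0n.
  by rewrite -partialE; exact: closed.
have [n an] : exists n, \sum_i a i = n.+1.
  case E: (\sum_i a i) => [|n]; last by exists n.
  case/eqP: a0; apply/ffunP => i; rewrite ffunE; apply/eqP.
  by move/eqP: E; rewrite sum_nat_eq0 => /forall_inP /(_ i isT).
apply: (descent n a 1 an (oner_neq0 _)).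
have -> : (fun x : 'rV[R]_d => 1 * monomial a x) = monomial a.
  by apply/funext => x; rewrite mul1r.
exact: poly_space_monomial.
Qed.

(** * Coefficients of the constants, and the filter *)

Lemma spd_unitmx {R : realType} {n : nat} (A : 'M[R]_n) :
  spd A -> A \in unitmx.
Proof.
case=> _ Apos; rewrite -row_free_unit -kermx_eq0; apply/negPn/negP => kA0.
pose v := nz_row (kermx A).
have vA0 : v *m A = 0 by apply/sub_kermxP; exact: nz_row_sub.
have /Apos : v^T != 0 by rewrite trmx_eq0 nz_row_eq0.
by rewrite trmxK vA0 mul0mx mxE ltxx.
Qed.

Section Operators.
Context {R : realType} {d : nat} {E : ref_element R d} (S : discretization E).

Local Notation V := (Vmx S).
Local Notation M := (Mmx S).

Definition represents (b : 'cV[R]_(Np S)) (f : 'rV[R]_d -> R) : Prop :=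
  forall x, f x = \sum_i b i ord0 * phi i x.

Lemma represents_exists (f : 'rV[R]_d -> R) :
  poly_space (calN S) f -> exists b, represents b f.
Proof.
move=> /phi_span[c fE]; exists (\col_i c i) => x.
by rewrite fE; apply: eq_bigr => i _; rewrite mxE.
Qed.

Lemma represents_inj (b b' : 'cV[R]_(Np S)) (f : 'rV[R]_d -> R) :
  represents b f -> represents b' f -> b = b'.
Proof.
move=> bf b'f; apply/colP => i; apply/eqP; rewrite -subr_eq0; apply/eqP.
apply: (@phi_free _ _ _ S (fun i => b i ord0 - b' i ord0)) => x.
by under eq_bigr do rewrite mulrBl; rewrite sumrB -bf -b'f subrr.
Qed.

Lemma represents_partial (b : 'cV[R]_(Np S)) (f : 'rV[R]_d -> R) (m : 'I_d) :
  represents b f -> represents (Dmx S m *m b) (partial m f).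
Proof.
move=> bf x.
have -> : f = \sum_(j < Np S) b j ord0 \*: phi j.
  by apply/funext => y; rewrite bf fct_sumE.
rewrite /partial derive_sum; last first.
  move=> j; apply: derivableZ; apply: poly_space_derivable; exact: phi_poly.
transitivity (\sum_j \sum_i b j ord0 * (Dmx S m i j * phi i x)).
  apply: eq_bigr => j _.
  rewrite deriveZ; last by apply: poly_space_derivable; exact: phi_poly.
  by rewrite -/(partial m (phi j) x) DmxE -mulr_sumr.
rewrite exchange_big; apply: eq_bigr => i _; rewrite mxE mulr_suml.
by apply: eq_bigr => j _; rewrite mulrCA mulrA.
Qed.

Lemma Vmx_represents (b : 'cV[R]_(Np S)) (f : 'rV[R]_d -> R) :
  represents b f -> V *m b = \col_i f (xv i).
Proof.
move=> bf; apply/colP => i; rewrite !mxE bf.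
by apply: eq_bigr => j _; rewrite mxE mulrC.
Qed.

Lemma Vfmx_represents (g : 'I_(Nf E)) (b : 'cV[R]_(Np S))
    (f : 'rV[R]_d -> R) :
  represents b f -> Vfmx S g *m b = \col_i f (xf i).
Proof.
move=> bf; apply/colP => i; rewrite !mxE bf.
by apply: eq_bigr => j _; rewrite mxE mulrC.
Qed.

Lemma Dmx_represents_cst (b : 'cV[R]_(Np S)) (c : R) (m : 'I_d) :
  represents b (cst c) -> Dmx S m *m b = 0.
Proof.
move=> /(represents_partial m) Db; apply: (represents_inj Db) => x.
rewrite /partial derive_cst big1 // => i _.
by rewrite mxE mul0r.
Qed.

Lemma Mmx_unit :
  \rank V = Np S -> spd (Wv S) -> M \in unitmx.
Proof.
move=> rV [Wsym Wpos]; apply: spd_unitmx; split.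
  by rewrite /Mmx !trmx_mul trmxK Wsym mulmxA.
move=> x x0; rewrite /Mmx !mulmxA -trmx_mul -(mulmxA _ V x); apply: Wpos.
rewrite -trmx_eq0 trmx_mul mulmx_free_eq0 ?trmx_eq0 //.
by rewrite /row_free mxrank_tr rV.
Qed.

Variables (Ms : {fset multiindex d}) (C : multiindex d -> R).
Local Notation K := (Kmx S Ms C).

Lemma Kmx_sym : (Wv S)^T = Wv S -> K^T = K.
Proof.
move=> Wsym; rewrite /Kmx raddf_sum; apply: eq_bigr => a _ /=.
by rewrite linearZ /= !trmx_mul !trmxK Wsym !mulmxA.
Qed.

(** A constant is a derivative of some element of the polynomial space, unless
    that space consists of constants only, so the range of the [Dmx S m], on
    which [K] vanishes, contains the constants. *)
Lemma Kmx_represents_cst (b : 'cV[R]_(Np S)) :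
  (forall m : 'I_d, K *m Dmx S m = 0) ->
  ((forall a, a \in calN S -> a = [ffun=> 0%N]) -> K = 0) ->
  represents b (cst 1) -> K *m b = 0.
Proof.
move=> KD0 trivialK b1.
have [N0|/existsNP[a /not_implyP[aN /eqP a0]]] :=
  pselect (forall a, a \in calN S -> a = [ffun=> 0%N]).
  by rewrite trivialK // mul0mx.
have [f [m [c [/represents_exists[e ef] c0 fc]]]] :=
  const_is_partial (@poly_space_deriv _ _ _ S) aN a0.
(* [c^-1 *: e] represents an antiderivative of [1]. *)
have De : Dmx S m *m e = c *: b.
  apply: represents_inj (represents_partial m ef) _ => x.
  rewrite fc -[c in LHS]mulr1 -[1]/(cst 1 x) b1 mulr_sumr.
  by apply: eq_bigr => i _; rewrite mxE mulrA.
have /(congr1 (mulmx K)) : b = c^-1 *: (Dmx S m *m e).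
  by rewrite De scalerA mulVf // scale1r.
by rewrite -scalemxAr mulmxA KD0 mul0mx scaler0.
Qed.

End Operators.

Section Elements.
Context {R : realType} {d : nat} {E : ref_element R d} (S : discretization E).
Variables (Me : mesh E) (Ms : {fset multiindex d}) (C : multiindex d -> R).
Local Notation M := (Mmx S).
Local Notation K := (Kmx S Ms C).

(** Filtering adds to the mass matrix a term that starts with [K], because
    [Pmx S *m Jmx S k *m Vmx S] is [M^-1 *m Mkmx S k]. *)
Lemma filtered_mass (k : 'I_(nelt Me)) :
  M \in unitmx -> M + K \in unitmx -> Mkmx S k \in unitmx ->
  Mkmx S k *m invmx (Fkmx S Ms C k) =
  Mkmx S k + K *m (invmx M *m Mkmx S k).
Proof.
move=> uM uMK uMk.
have [Q QE] : exists Q, Q = invmx M *m Mkmx S k by eexists.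
have -> : Fkmx S Ms C k = invmx Q *m Fmx S Ms C *m Q.
  by rewrite /Fkmx QE /Pmx /Mkmx /= !mulmxA.
have uQ : Q \in unitmx by rewrite QE unitmx_mul unitmx_inv uM.
have GE : 1%:M + invmx M *m K = invmx M *m (M + K).
  by rewrite mulmxDr mulVmx.
have uG : 1%:M + invmx M *m K \in unitmx.
  by rewrite GE unitmx_mul unitmx_inv uM.
have FkV : invmx (invmx Q *m Fmx S Ms C *m Q) =
    invmx Q *m (1%:M + invmx M *m K) *m Q.
  set A := invmx Q *m _ *m Q; set B := _ *m Q.
  have uA : A \in unitmx by rewrite /A /Fmx !unitmx_mul !unitmx_inv uQ uG.
  have AB : A *m B = 1%:M.
    by rewrite /A /B /Fmx !mulmxA mulmxK // mulmxKV // mulVmx.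
  by rewrite -[LHS]mulmx1 -AB mulKmx.
rewrite FkV !mulmxA.
have -> : Mkmx S k *m invmx Q = M.
  by rewrite -[RHS](mulmxK uQ) QE mulKVmx.
by rewrite mulmxDr mulmx1 mulKVmx // mulmxDl QE mulKVmx // !mulmxA.
Qed.

End Elements.

(** * Local conservation *)

Lemma is_derive_mulmx_row {R : realType} {n : nat} (B : 'rV[R]_n)
    (v : R -> 'cV[R]_n) (t : R) :
  derivable v t 1 ->
  is_derive t 1 (fun s => (B *m v s) ord0 ord0)
    ((B *m derive1 v t) ord0 ord0).
Proof.
move=> dv.
have -> : (fun s => (B *m v s) ord0 ord0) =
    \sum_(i < n) B ord0 i \*: (fun s => v s i ord0).
  by apply/funext => s; rewrite mxE fct_sumE.
have -> : (B *m derive1 v t) ord0 ord0 =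
    \sum_(i < n) B ord0 i *: 'D_1 (fun s => v s i ord0) t.
  by rewrite mxE; apply: eq_bigr => i _; rewrite derive1E derive_mx // mxE.
apply: is_derive_sum => i; apply: is_deriveZ; apply: derivableP.
by move/derivable_mxP : dv; apply.
Qed.

Section LocalConservation.
Context {R : realType} {d Neq : nat} {E : ref_element R d}.
Context {S : discretization E} {Me : mesh E}.
Variables (F : 'I_d -> 'rV[R]_Neq -> 'rV[R]_Neq)
  (Fstar : 'rV[R]_Neq -> 'rV[R]_Neq -> 'rV[R]_d -> 'rV[R]_Neq)
  (T : R) (u : 'I_(nelt Me) -> 'I_Neq -> R -> 'cV[R]_(Np S))
  (Uext : forall q : 'I_(nelt Me) * 'I_(Nf E),
       'I_(Nq S q.2) -> R -> 'rV[R]_Neq).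

(** Testing the method against the constant [1] kills the volume term, because
    the derivatives of a constant vanish, and turns the mass and facet terms
    into the cell total and the facet fluxes. *)
Lemma dg_locally_conservative (A : 'I_(nelt Me) -> 'M[R]_(Np S))
    (b : 'cV[R]_(Np S)) :
  represents b (cst 1) ->
  (forall k, b^T *m A k = b^T *m Mkmx S k) ->
  dg_method F Fstar u Uext A T -> locally_conservative Fstar u Uext T.
Proof.
move=> b1 bA dg k e t tT; have [du] := dg k e t tT.
have bV : (ones R (Nv S))^T = b^T *m (Vmx S)^T.
  rewrite -trmx_mul (Vmx_represents b1); congr (_^T).
  by apply/colP => i; rewrite !mxE.
have bVf g : (ones R (Nq S g))^T = b^T *m (Vfmx S g)^T.
  rewrite -trmx_mul (Vfmx_represents g b1); congr (_^T).
  by apply/colP => i; rewrite !mxE.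
have bD m : b^T *m (Dmx S m)^T = 0.
  by rewrite -trmx_mul (Dmx_represents_cst m b1) trmx0.
move=> /(congr1 (fun w => (b^T *m w) ord0 ord0)).
rewrite mulmxDr mulmxBr !mulmx_sumr mulmx0.
rewrite [X in _ - X]big1 ?subr0; last first.
  by move=> m _; rewrite !mulmxA bD !mul0mx.
rewrite mulmxA bA => balance.
have totalE : cell_total u k e =
    (fun s => ((b^T *m Mkmx S k) *m u k e s) ord0 ord0).
  by apply/funext => s; rewrite /cell_total bV /Mkmx !mulmxA.
have [Dtotal totalD] := is_derive_mulmx_row (b^T *m Mkmx S k) du.
rewrite totalE; split; first exact: Dtotal.
rewrite derive1E totalD; move: balance; rewrite [LHS]mxE [RHS]mxE summxE => balance.
rewrite -[RHS]balance.
congr (_ + _).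
by apply: eq_bigr => g _; rewrite /facet_flux bVf !mulmxA.
Qed.

End LocalConservation.

(** * Tangent hyperplanes and unit normals *)

Section DotProduct.
Context {R : realType} {d : nat}.
Implicit Types x y z : 'rV[R]_d.

Lemma dotE x y : dot x y = \sum_i x ord0 i * y ord0 i.
Proof. by rewrite /dot mxE; apply: eq_bigr => i _; rewrite mxE. Qed.

Lemma dotC x y : dot x y = dot y x.
Proof. by rewrite !dotE; apply: eq_bigr => i _; rewrite mulrC. Qed.

Lemma dotDr x y z : dot x (y + z) = dot x y + dot x z.
Proof. by rewrite /dot linearD /= mulmxDr mxE. Qed.

Lemma dotZr x (a : R) y : dot x (a *: y) = a * dot x y.
Proof. by rewrite /dot linearZ /= -scalemxAr mxE. Qed.

Lemma dotZl x (a : R) y : dot (a *: x) y = a * dot x y.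
Proof. by rewrite dotC dotZr dotC. Qed.

Lemma dotBr x y z : dot x (y - z) = dot x y - dot x z.
Proof. by rewrite dotDr -scaleN1r dotZr mulN1r. Qed.

Lemma dotxx_ge0 x : 0 <= dot x x.
Proof. by rewrite dotE; apply: sumr_ge0 => i _; rewrite -expr2 sqr_ge0. Qed.

Lemma dotxx_eq0 x : dot x x = 0 -> x = 0.
Proof.
rewrite dotE => /eqP; rewrite psumr_eq0 => [/allP x0|i _]; last first.
  by rewrite -expr2 sqr_ge0.
apply/rowP => i; have := x0 i; rewrite mem_index_enum -expr2 sqrf_eq0 mxE.
by move=> /(_ isT) /eqP.
Qed.

Lemma sphere_dot x : sphere x -> dot x x = 1.
Proof.
by rewrite /sphere /enorm /= => x1; rewrite -(sqr_sqrtr (dotxx_ge0 x)) x1 expr1n.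
Qed.

Lemma dot_continuous x : continuous (dot x).
Proof.
move=> y; have -> : dot x = \sum_i (fun z => x ord0 i * z ord0 i).
  by apply/funext => z; rewrite dotE fct_sumE.
elim/big_ind: _ => [|f g fy gy|i _]; first exact: cst_continuous.
  exact: continuousD.
by apply: continuousM; [exact: cst_continuous|exact: coord_continuous].
Qed.

End DotProduct.

(** The covectors that annihilate the image under an invertible map of a
    hyperplane form a line, which contains only two unit vectors. *)
Lemma unit_annihilators {R : realType} {d : nat} (J : 'M[R]_d)
    (nu n n' : 'rV[R]_d) :
  J \in unitmx -> sphere nu -> sphere n -> sphere n' ->
  (forall v, dot nu v = 0 -> dot n (v *m J) = 0) ->
  (forall v, dot nu v = 0 -> dot n' (v *m J) = 0) ->
  n' = n \/ n' = - n.
Proof.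
move=> uJ /sphere_dot nu1 /sphere_dot n1 /sphere_dot n'1.
have line (w : 'rV[R]_d) : (forall v, dot nu v = 0 -> dot w (v *m J) = 0) ->
    exists a : R, w = a *: (nu *m invmx J^T).
  move=> wJ; pose z := w *m J^T.
  have zE v : dot w (v *m J) = dot z v by rewrite /dot trmx_mul mulmxA.
  exists (dot z nu).
  (* The component of [z] orthogonal to [nu] is a test vector for itself. *)
  pose r := z - dot z nu *: nu.
  have nur : dot nu r = 0 by rewrite dotBr dotZr nu1 mulr1 dotC subrr.
  have /dotxx_eq0 : dot r r = 0.
    by rewrite {2}/r dotBr dotZr (dotC r nu) nur mulr0 subr0 dotC -zE wJ.
  move/eqP; rewrite subr_eq0 => /eqP zE'.
  by rewrite scalemxAl -zE' /z mulmxK // unitmx_tr.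
move=> /line[a na] /line[b nb]; move: n1 n'1.
rewrite na nb !dotZr !dotZl !mulrA; set c := dot _ _ => a1 b1.
have /eqP : a ^+ 2 = b ^+ 2.
  by rewrite -[LHS]mulr1 -b1 -[RHS]mulr1 -[X in _ = _ * X]a1; ring.
rewrite eqf_sqr => /orP[/eqP->|/eqP->]; first by left.
by right; rewrite scaleNr opprK.
Qed.

(** The difference quotients of [t |-> X (t *: v + x)] are orthogonal to [n] up
    to a relative error [eps], and so is their limit, for every [eps].  One-sided
    quotients suffice as [X] is known to be differentiable. *)
Lemma dot_derive_eq0 {R : realType} {d : nat} (G : set 'rV[R]_d)
    (X : 'rV[R]_d -> 'rV[R]_d) (x v n : 'rV[R]_d) :
  differentiable X x ->
  (forall eps : R, 0 < eps ->
     \forall y \near X x, G y -> `|dot n (y - X x)| <= eps * `|y - X x|) ->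
  (\forall t \near (0 : R)^'+, G (X (t *: v + x))) ->
  dot n ('D_v X x) = 0.
Proof.
move=> dX nG Gt.
pose quot (t : R) := t^-1 *: (X (t *: v + x) - X x).
have quotD : quot t @[t --> 0^'+] --> 'D_v X x.
  apply: cvg_dnbhs_at_right.
  have dvX : derivable X x v by exact: diff_derivable.
  exact: dvX.
have Xt : X (t *: v + x) @[t --> 0^'+] --> X x.
  apply: cvg_within_filter.
  have cX : {for 0 *: v + x, continuous X}.
    by rewrite scale0r add0r; exact: differentiable_continuous.
  have : (fun t : R => t *: v + x) t @[t --> (0 : R)] --> 0 *: v + x.
    by apply: cvgD; [apply: cvgZr_tmp; exact: cvg_id|exact: cvg_cst].
  by move=> /(continuous_cvg _ cX); rewrite scale0r add0r.
have small eps : 0 < eps -> `|dot n ('D_v X x)| <= eps * `|'D_v X x|.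
  move=> eps0.
  have cl : `|dot n (quot t)| @[t --> 0^'+] --> `|dot n ('D_v X x)|.
    apply: cvg_norm; apply: continuous_cvg quotD; exact: dot_continuous.
  have cr : eps * `|quot t| @[t --> 0^'+] --> eps * `|'D_v X x|.
    by apply: cvgMl_tmp; apply: cvg_norm.
  apply: ler_cvg_to cl cr _.
  apply: filterS3 (nbhs_right_gt 0) Gt (Xt _ (nG _ eps0)) => t t0 GXt /(_ GXt).
  by rewrite /quot dotZr normrM normrZ mulrCA => ?; exact: ler_wpM2l.
apply/eqP; rewrite -normr_eq0 eq_le normr_ge0 andbT.
apply/ler_addgt0Pr => e e0; rewrite add0r.
have D1 : 0 < `|'D_v X x| + 1 by rewrite ltr_wpDl.
apply: le_trans (small (e / (`|'D_v X x| + 1)) _) _; first exact: divr_gt0.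
by rewrite mulrAC ler_pdivrMr // ler_pM2l // lerDl.
Qed.

(** * Relative interiors of facets *)

Section Facets.
Context {R : realType} {d : nat} {E : ref_element R d}.

Definition relint (g : 'I_(Nf E)) : set 'rV[R]_d :=
  [set x | dot (nhat g) x = bhat g /\
           forall h, h != g -> dot (nhat h) x < bhat h].

Lemma relint_Gamma_hat (g : 'I_(Nf E)) : relint g `<=` Gamma_hat g.
Proof.
move=> x [xg xh]; split=> // h; have [->|/xh/ltW//] := eqVneq h g.
by rewrite xg.
Qed.

Lemma relint_segment (g : 'I_(Nf E)) (x z : 'rV[R]_d) (t : R) :
  Gamma_hat g x -> relint g z -> 0 < t < 1 -> relint g (t *: (z - x) + x).
Proof.
move=> [xO xg] [zg zh] /andP[t0 t1]; split=> [|h hg].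
  by rewrite dotDr dotZr dotBr zg xg subrr mulr0 add0r.
rewrite dotDr dotZr dotBr.
have -> : t * (dot (nhat h) z - dot (nhat h) x) + dot (nhat h) x =
   t * dot (nhat h) z + (1 - t) * dot (nhat h) x by ring.
have -> : bhat h = t * bhat h + (1 - t) * bhat h by ring.
apply: ltr_leD; first by rewrite ltr_pM2l // zh.
by rewrite ler_pM2l ?subr_gt0 //; exact: xO.
Qed.

Lemma relint_tangent (g : 'I_(Nf E)) (x v : 'rV[R]_d) :
  relint g x -> dot (nhat g) v = 0 ->
  \forall t \near (0 : R)^'+, relint g (t *: v + x).
Proof.
move=> [xg xh] vg.
have lth : \forall t \near (0 : R)^'+,
    forall h, h != g -> dot (nhat h) (t *: v + x) < bhat h.
  apply: filter_forall => h; have [->|hg] := eqVneq h g.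
    exact: nearW.
  have : t * dot (nhat h) v + dot (nhat h) x @[t --> (0 : R)^'+] -->
      0 * dot (nhat h) v + dot (nhat h) x.
    apply: cvgD; last exact: cvg_cst.
    by apply: cvgMr_tmp; apply: cvg_within_filter; exact: cvg_id.
  rewrite mul0r add0r => /cvgr_lt /(_ (bhat h) (xh h hg)).
  by apply: filterS => t /=; rewrite dotDr dotZr.
by apply: filterS lth => t lth; split=> //; rewrite dotDr dotZr vg mulr0 add0r.
Qed.

Lemma relint_nonempty (g : 'I_(Nf E)) : relint g !=set0.
Proof. by have [x] := Gamma_hat_facet g; exists x. Qed.

Lemma Gamma_hat_compact (g : 'I_(Nf E)) : compact (Gamma_hat g).
Proof.
have -> : Gamma_hat g = Omega_hat E `&` [set x | dot (nhat g) x = bhat g].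
  by apply/seteqP; split=> x [].
apply: compact_closedI; first exact: Omega_hat_compact.
have /continuous_closedP : continuous (dot (nhat g)) by exact: dot_continuous.
by move=> /(_ _ (@closed_eq _ (bhat g))).
Qed.

Variable Me : mesh E.

Local Notation facet := (facet (m := Me)).
Local Notation elt := (elt (m := Me)).

Definition other_facets (q : 'I_(nelt Me) * 'I_(Nf E)) : set 'rV[R]_d :=
  \bigcup_(g in [set g | g != q.2]) facet (q.1, g).

Lemma Xmap_differentiable (k : 'I_(nelt Me)) (x : 'rV[R]_d) :
  Omega_hat E x -> differentiable (Xmap k) x.
Proof. by move=> xO; have [U [_ OU /(_ [::] x (OU x xO))]] := Xmap_smooth k. Qed.

Lemma facet_compact (q : 'I_(nelt Me) * 'I_(Nf E)) : compact (facet q).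
Proof.
apply: continuous_compact; last exact: Gamma_hat_compact.
apply/subspace_continuousP => x [xO _]; apply: cvg_within_filter.
exact/differentiable_continuous/Xmap_differentiable.
Qed.

Lemma other_facets_closed (q : 'I_(nelt Me) * 'I_(Nf E)) :
  closed (other_facets q).
Proof.
apply: closed_bigcup => [|g _]; first exact: finite_finset.
by apply: compact_closed; [exact: norm_hausdorff|exact: facet_compact].
Qed.

Lemma relint_other_facets (q : 'I_(nelt Me) * 'I_(Nf E)) (x : 'rV[R]_d) :
  relint q.2 x -> ~ other_facets q (Xmap q.1 x).
Proof.
move=> xq [g /= gq [y yg yx]].
have xO := (relint_Gamma_hat xq).1.
have xy : y = x by apply: (@Xmap_inj _ _ _ _ q.1); rewrite ?inE //; exact: yg.1.
by have := xq.2 g gq; rewrite -xy yg.2 ltxx.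
Qed.

(** Segments from a point of the facet to a point of its relative interior lie
    in the relative interior but for their origin. *)
Lemma relint_dense (q : 'I_(nelt Me) * 'I_(Nf E)) (x : 'rV[R]_d)
    (U : set 'rV[R]_d) :
  facet q x -> nbhs x U -> exists2 y, relint q.2 y & U (Xmap q.1 y).
Proof.
move=> [y yG <-] XyU; have [z zr] := relint_nonempty q.2.
have Ut : \forall t \near (0 : R)^'+, U (Xmap q.1 (t *: (z - y) + y)).
  have : Xmap q.1 (t *: (z - y) + y) @[t --> (0 : R)^'+] --> Xmap q.1 y.
    apply: cvg_within_filter.
    have cX : {for 0 *: (z - y) + y, continuous (Xmap q.1)}.
      rewrite scale0r add0r; apply: differentiable_continuous.
      exact: Xmap_differentiable yG.1.
    have : (fun t : R => t *: (z - y) + y) t @[t --> (0 : R)] -->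
        0 *: (z - y) + y.
      by apply: cvgD; [apply: cvgZr_tmp; exact: cvg_id|exact: cvg_cst].
    by move=> /(continuous_cvg _ cX); rewrite scale0r add0r.
  by apply.
near (0 : R)^'+ => t.
exists (t *: (z - y) + y); last by near: t.
apply: relint_segment => //; apply/andP; split; near: t.
  exact: nbhs_right_gt.
exact: nbhs_right_lt.
Unshelve. all: by end_near. Qed.

End Facets.

(** * Normals on coincident facets *)

Section CoincidentFacets.
Context {R : realType} {d : nat} {E : ref_element R d} {Me : mesh E}.
Implicit Types q : 'I_(nelt Me) * 'I_(Nf E).

Local Notation facet := (facet (m := Me)).
Local Notation elt := (elt (m := Me)).
Local Notation normal := Defs.normal.

Lemma relint_preimage q (y : 'rV[R]_d) :
  facet q y -> ~ other_facets q y -> exists2 x, relint q.2 x & Xmap q.1 x = y.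
Proof.
move=> [x [xO xg] <-] nGx; exists x => //; split=> // h hq.
rewrite lt_neqAle xO andbT; apply/eqP => xh.
by apply: nGx; exists h => //; exists x.
Qed.

(** The facets of one element are images of distinct facets of the reference
    element under an injective map, so two coincident facets belong to different
    elements. *)
Lemma facet_inj q q' : q.1 = q'.1 -> facet q' = facet q -> q' = q.
Proof.
case: q q' => [k g] [k' h] /= kk'; rewrite -{}kk' => fE.
have [-> //|gh] := eqVneq h g.
have [x xg] := relint_nonempty g.
have xO := (relint_Gamma_hat xg).1.
case: (@relint_other_facets _ _ _ _ (k, g) x xg).
exists h => //; rewrite fE; exists x => //; exact: relint_Gamma_hat.
Qed.

(** Both normals annihilate the tangent hyperplane of the common facet. *)
Lemma normals_parallel q q' (x : 'rV[R]_d) :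
  facet q' = facet q -> relint q.2 x ->
  normal q' (Xmap q.1 x) = normal q (Xmap q.1 x) \/
  normal q' (Xmap q.1 x) = - normal q (Xmap q.1 x).
Proof.
move=> fE xq; have xG := relint_Gamma_hat xq.
have yq : facet q (Xmap q.1 x) by exists x.
have dX := Xmap_differentiable q.1 xG.1.
have [_ sq oq _] := Defs.normalP q; have [_ sq' oq' _] := Defs.normalP q'.
rewrite fE in sq' oq'.
have annihilates (n : 'rV[R]_d) : (forall eps : R, 0 < eps ->
      \forall y \near Xmap q.1 x, facet q y ->
        `|dot n (y - Xmap q.1 x)| <= eps * `|y - Xmap q.1 x|) ->
    forall v, dot (nhat q.2) v = 0 -> dot n (v *m 'J (Xmap q.1) x) = 0.
  move=> on v vq; rewrite -deriveEjacobian //.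
  apply: (dot_derive_eq0 dX on); apply: filterS (relint_tangent xq vq) => t tq.
  by exists (t *: v + x) => //; exact: relint_Gamma_hat.
apply: (@unit_annihilators _ _ ('J (Xmap q.1) x) (nhat q.2)).
- by have := Xmap_det q.1 xG.1; rewrite unitmxE unitfE /jacmx det_tr => /gt_eqF->.
- exact: nhat_unit.
- exact: sq.
- exact: sq'.
- by apply: annihilates; exact: oq.
- by apply: annihilates; exact: oq'.
Qed.

(** At a point that is interior to the facet for both elements, equal normals
    would make the elements overlap behind the facet. *)
Lemma normals_opposite_relint q q' (x x' : 'rV[R]_d) :
  q.1 != q'.1 -> facet q' = facet q -> relint q.2 x -> relint q'.2 x' ->
  Xmap q'.1 x' = Xmap q.1 x ->
  normal q' (Xmap q.1 x) = - normal q (Xmap q.1 x).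
Proof.
move=> qq' fE xq xq' xx'.
have [nE|//] := normals_parallel fE xq; exfalso.
have yq : facet q (Xmap q.1 x) by exists x => //; exact: relint_Gamma_hat.
have [_ _ _ inq] := Defs.normalP q; have [_ _ _ inq'] := Defs.normalP q'.
have nG := relint_other_facets xq.
have nG' : ~ other_facets q' (Xmap q.1 x).
  by rewrite -xx'; exact: relint_other_facets.
have yq' : facet q' (Xmap q.1 x) by rewrite fE.
(* A point slightly behind the facet is interior to both elements. *)
near (0 : R)^'+ => t.
suff : (interior (elt q.1) `&` interior (elt q'.1))
    (Xmap q.1 x - t *: normal q (Xmap q.1 x)) by rewrite elt_disjoint.
split.
  suff [] : interior (elt q.1) (Xmap q.1 x - t *: normal q (Xmap q.1 x)) /\
    ~ elt q.1 (Xmap q.1 x + t *: normal q (Xmap q.1 x)) by [].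
  by near: t; exact: inq.
suff [] : interior (elt q'.1) (Xmap q.1 x - t *: normal q (Xmap q.1 x)) /\
  ~ elt q'.1 (Xmap q.1 x + t *: normal q (Xmap q.1 x)) by [].
by near: t; rewrite -nE; exact: inq'.
Unshelve. all: by end_near. Qed.

(** The points interior to the facet for one element are dense in it, and they
    are open because the other facets are closed; so the points interior for
    both elements are dense, and continuity carries the identity to the edges
    and corners of the facet. *)
Lemma normals_opposite q q' (x : 'rV[R]_d) :
  q' != q -> facet q' = facet q -> facet q x -> normal q' x = - normal q x.
Proof.
move=> q'q fE xq.
have qq' : q.1 != q'.1.
  by apply: contra_neq q'q => /facet_inj; apply.
have [cq _ _ _] := Defs.normalP q; have [cq' _ _ _] := Defs.normalP q'.
apply/eqP; rewrite -subr_eq0 opprK; apply/negPn/negP => nx0.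
have : normal q' y + normal q y @[y --> within (facet q) (nbhs x)] -->
    normal q' x + normal q x.
  apply: cvgD; last by move/subspace_continuousP: cq; apply.
  by move/subspace_continuousP: cq'; rewrite fE; apply.
move=> /cvg_norm /cvgr_gt /(_ 0); rewrite normr_gt0 => /(_ nx0).
rewrite near_withinE => /nbhs_interior near_x.
have [y yq /= nyU] := relint_dense xq near_x.
have nGy := relint_other_facets yq.
have fy : facet q' (Xmap q.1 y).
  by rewrite fE; exists y => //; exact: relint_Gamma_hat.
have near_y : nbhs (Xmap q.1 y)
    ([set z | facet q z -> 0 < `|normal q' z + normal q z|]
       `&` ~` other_facets q).
  apply: filterI; first exact: nyU.
  by apply: open_nbhs_nbhs; split=> //; apply/closed_openC/other_facets_closed.
have [z zq' [nz nGz]] := relint_dense fy near_y.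
have fz : facet q (Xmap q'.1 z).
  by rewrite -fE; exists z => //; exact: relint_Gamma_hat.
have [w wq wz] := relint_preimage fz nGz.
have := nz fz; rewrite -wz (normals_opposite_relint qq' fE wq zq') //.
by rewrite addNr normr0 ltxx.
Qed.

End CoincidentFacets.

(** Iterating a nonzero translation leaves every bounded set. *)
Lemma compact_translation_eq0 {R : realType} {d : nat} (A : set 'rV[R]_d)
    (s : 'rV[R]_d) :
  compact A -> A !=set0 -> (forall x, A x -> A (x + s)) -> s = 0.
Proof.
move=> /compact_bounded [M [_ AM]] [x Ax] As.
have An n : A (x + s *+ n).
  by elim: n => [|n IH]; rewrite ?mulr0n ?addr0 // mulrSr addrA; exact: As.
apply/eqP; rewrite -normr_eq0; apply/negPn/negP => s0.
have s_gt0 : 0 < `|s| by rewrite lt_neqAle eq_sym s0 normr_ge0.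
pose B : R := (`|M| + 1 + `|x|) / `|s|.
have B0 : 0 <= B by rewrite divr_ge0 // !addr_ge0.
have := AM (`|M| + 1) _ _ (An (Num.bound B)).
rewrite (le_lt_trans (ler_norm M)) ?ltrDl // => /(_ isT) bound.
have : `|s| *+ Num.bound B <= `|M| + 1 + `|x|.
  rewrite -normrMn -[s *+ _](addKr x) addrC; apply: le_trans (ler_normB _ _) _.
  exact: lerD.
rewrite -mulr_natl -ler_pdivlMr // leNgt => /negP; apply.
exact: archi_boundP.
Qed.

(** * Cancellation of interior fluxes *)

Section GlobalConservation.
Context {R : realType} {d Neq : nat} {E : ref_element R d}.
Context {S : discretization E} {Me : mesh E}.
Implicit Types q : 'I_(nelt Me) * 'I_(Nf E).

Local Notation facet := (facet (m := Me)).
Local Notation normal := Defs.normal.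

Section Neighbours.
Variable Cf : conformity S Me.
Local Notation nbr := (nbr Cf).
Local Notation shift := (Defs.shift Cf).

Lemma facet_nbr q : q \in Kint Me ->
  facet (nbr q) = [set x + shift q | x in facet q].
Proof.
move=> qK; have [qp|/(nbr_coincident Cf qK)[-> ->]] := boolP (q \in Defs.periodic Me).
  by have [] := nbr_periodic Cf qK qp.
apply/seteqP; split=> x; first by move=> fx; exists x; rewrite ?addr0.
by case=> y fy <-; rewrite addr0.
Qed.

(** Going to the neighbour and back translates the compact set [facet q] into
    itself. *)
Lemma shift_nbr q : q \in Kint Me -> shift (nbr q) = - shift q.
Proof.
move=> qK; have [nqK _ nnq] := nbr_pairing Cf qK.
apply/eqP; rewrite -addr_eq0; apply/eqP.
apply: (compact_translation_eq0 (@facet_compact _ _ _ _ q)) => [|x fx].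
  have [x xq] := relint_nonempty q.2.
  by exists (Xmap q.1 x), x => //; exact: relint_Gamma_hat.
rewrite -[X in facet X]nnq facet_nbr //; exists (x + shift q).
  by rewrite facet_nbr //; exists x.
by rewrite -addrA [shift q + _]addrC.
Qed.

Lemma normal_nbr q (x : 'rV[R]_d) : q \in Kint Me -> facet q x ->
  normal (nbr q) (x + shift q) = - normal q x.
Proof.
move=> qK fx; have [_ nq _] := nbr_pairing Cf qK.
have [qp|/(nbr_coincident Cf qK)[fE ->]] := boolP (q \in Defs.periodic Me).
  by have [_ _] := nbr_periodic Cf qK qp; apply.
by rewrite addr0; exact: normals_opposite.
Qed.

Lemma nbr_node_nbr q (qK : q \in Kint Me) (nqK : nbr q \in Kint Me)
    (i : 'I_(Nq S q.2)) :
  Xmap (nbr (nbr q)).1 (xf (nbr_node Cf nqK (nbr_node Cf qK i))) =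
  Xmap q.1 (xf i).
Proof.
rewrite -(nbr_nodeP Cf nqK) -(nbr_nodeP Cf qK) shift_nbr //.
by rewrite addrK.
Qed.

End Neighbours.

(** Node matching is stated between physical points; reference points are
    recovered because each element map is injective. *)
Lemma Uh_node (u : 'I_(nelt Me) -> 'I_Neq -> R -> 'cV[R]_(Np S))
    q q' (i : 'I_(Nq S q.2)) (j : 'I_(Nq S q'.2)) (t : R) :
  q' = q -> Xmap q'.1 (xf j) = Xmap q.1 (xf i) ->
  Uh u q'.1 (xf j) t = Uh u q.1 (xf i) t.
Proof.
move=> q'q; move: j; rewrite {}q'q => j Xji; congr (Uh u _ _ t).
by apply: Xmap_inj Xji; rewrite inE; exact: (xf_in _).1.
Qed.

(** The permutation of the nodes is absorbed because it fixes the vector of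
    ones. *)
Lemma opposite_weighted_sums (n1 n2 : nat) (n12 : n1 = n2)
    (A : 'M[R]_n1) (B : 'M[R]_n2) (s : 'S_n2)
    (a : 'cV[R]_n1) (b : 'cV[R]_n2) :
  castmx (n12, n12) A = (perm_mx s)^T *m B *m perm_mx s ->
  (forall i, a (cast_ord (esym n12) (s i)) ord0 = - b i ord0) ->
  ((ones R n1)^T *m A *m a) ord0 ord0 = - ((ones R n2)^T *m B *m b) ord0 ord0.
Proof.
case: n2 / n12 B s b => B s b; rewrite castmx_id => -> ab.
have -> : (ones R n1)^T *m ((perm_mx s)^T *m B *m perm_mx s) *m a =
    (perm_mx s *m ones R n1)^T *m B *m (perm_mx s *m a).
  by rewrite trmx_mul !mulmxA.
have -> : perm_mx s *m ones R n1 = ones R n1.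
  by rewrite -row_permE; apply/colP => i; rewrite !mxE.
have -> : perm_mx s *m a = - b.
  rewrite -row_permE; apply/colP => i; rewrite !mxE -ab.
  by congr (a _ _); apply: val_inj.
by rewrite mulmxN mxE.
Qed.

Variables (Fstar : 'rV[R]_Neq -> 'rV[R]_Neq -> 'rV[R]_d -> 'rV[R]_Neq)
  (T : R) (u : 'I_(nelt Me) -> 'I_Neq -> R -> 'cV[R]_(Np S))
  (Uext : forall q : 'I_(nelt Me) * 'I_(Nf E),
       'I_(Nq S q.2) -> R -> 'rV[R]_Neq).

(** The factor [jacf] of [fstar] is left out, to be counted with the weights:
    neighbouring facets have matching products [Wf *m Jfmx], whereas the factors
    may differ. *)
Definition nodal_flux q (e : 'I_Neq) (t : R) : 'cV[R]_(Nq S q.2) :=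
  \col_i Fstar (Uh u q.1 (xf i) t) (Uext i t) (normal q (Xmap q.1 (xf i)))
    ord0 e.

Lemma facet_fluxE q (e : 'I_Neq) (t : R) :
  facet_flux Fstar u Uext q e t =
  ((ones R (Nq S q.2))^T *m (Wf S q.2 *m Jfmx S q) *m nodal_flux q e t)
    ord0 ord0.
Proof.
case: q => k g; rewrite /facet_flux -!mulmxA; congr ((_ *m (_ *m _)) _ _).
by apply/colP => i; rewrite mul_diag_mx !mxE.
Qed.

Variable Upsilon : set 'rV[R]_Neq.
Hypothesis Uh_in : forall k x (t : R), Omega_hat E x -> 0 < t < T ->
  Upsilon (Uh u k x t).
Hypothesis Uext_in : forall q (i : 'I_(Nq S q.2)) (t : R), 0 < t < T ->
  Upsilon (Uext i t).
Hypothesis Fstar_anti : forall U V n, Upsilon U -> Upsilon V -> sphere n ->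
  Fstar U V n = - Fstar V U (- n).
Variable Cf : conformity S Me.
Hypothesis Uext_nbr : forall q (qK : q \in Kint Me) (i : 'I_(Nq S q.2)) (t : R),
  0 < t < T -> Uext i t = Uh u (nbr Cf q).1 (xf (nbr_node Cf qK i)) t.

(** Seen from the neighbour, the interior trace and the external data exchange
    their roles and the normal is reversed. *)
Lemma facet_flux_nbr q (e : 'I_Neq) (t : R) : 0 < t < T -> q \in Kint Me ->
  facet_flux Fstar u Uext (nbr Cf q) e t = - facet_flux Fstar u Uext q e t.
Proof.
move=> tT qK; have [nqK _ nnq] := nbr_pairing Cf qK.
rewrite !facet_fluxE; apply: (opposite_weighted_sums (nbr_weights Cf qK)) => i.
have fx : facet q (Xmap q.1 (xf i)) by exists (xf i) => //; exact: xf_in.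
rewrite -[cast_ord _ _]/(nbr_node Cf qK i) !mxE -(nbr_nodeP Cf qK) normal_nbr //.
rewrite (Uext_nbr nqK) // -(Uext_nbr qK) //.
rewrite (Uh_node u t nnq (nbr_node_nbr qK nqK i)).
rewrite [in RHS]Fstar_anti ?mxE ?opprK //.
- by apply: Uh_in => //; exact: (xf_in _).1.
- exact: Uext_in.
- by have [_ sq _ _] := Defs.normalP q; exact: sq.
Qed.

(** The neighbour map is an involution of the interior facets that reverses the
    flux, so their total flux equals its own opposite. *)
Lemma interior_flux_eq0 (e : 'I_Neq) (t : R) : 0 < t < T ->
  \sum_(q in Kint Me) facet_flux Fstar u Uext q e t = 0.
Proof.
move=> tT; set s := \sum_(_ in _) _.
suff : s = - s by lra.
rewrite {1}/s (reindex_onto (nbr Cf) (nbr Cf)) /=; last first.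
  by move=> q /(nbr_pairing Cf)[].
rewrite /s -sumrN; apply: eq_big => [q|q /andP[nqK /eqP nnq]].
  apply/andP/idP => [[nqK /eqP nnq]|/(nbr_pairing Cf)[-> _ ->] //].
  by rewrite -nnq; have [] := nbr_pairing Cf nqK.
apply: facet_flux_nbr => //.
by rewrite -nnq; have [] := nbr_pairing Cf nqK.
Qed.

Lemma globally_conservative_of_locally :
  locally_conservative Fstar u Uext T -> globally_conservative Fstar u Uext T.
Proof.
move=> local e t tT.
have -> : (fun s => \sum_k cell_total u k e s) = \sum_k cell_total u k e.
  by apply/funext => s; rewrite fct_sumE.
have dk k : derivable (cell_total u k e) t 1 by have [] := local k e t tT.
split; first exact: derivable_sum.
rewrite derive1E derive_sum //.
have -> : \sum_(k < nelt Me) 'D_1 (cell_total u k e) t =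
    - \sum_q facet_flux Fstar u Uext q e t.
  rewrite -(pair_bigA _ (fun k g => facet_flux Fstar u Uext (k, g) e t)) /=.
  rewrite -sumrN; apply: eq_bigr => k _; apply/eqP; rewrite -addr_eq0.
  by have [_] := local k e t tT; rewrite derive1E => ->.
rewrite (bigID (mem (Kbdry Me))) /= opprD addrAC addNr add0r.
rewrite (eq_bigl (fun q => q \in Kint Me)); last first.
  by move=> q; rewrite !inE.
by rewrite interior_flux_eq0 // oppr0.
Qed.

End GlobalConservation.

Theorem theorem4p3 (R : realType) (d Neq : nat) (E : ref_element R d)
    (S : discretization E) (Ms : {fset multiindex d}) (C : multiindex d -> R)
    (Me : mesh E) (Upsilon : set 'rV[R]_Neq)
    (F : 'I_d -> 'rV[R]_Neq -> 'rV[R]_Neq)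
    (Fstar : 'rV[R]_Neq -> 'rV[R]_Neq -> 'rV[R]_d -> 'rV[R]_Neq)
    (T : R) (u : 'I_(nelt Me) -> 'I_Neq -> R -> 'cV[R]_(Np S))
    (Uext : forall q : 'I_(nelt Me) * 'I_(Nf E),
       'I_(Nq S q.2) -> R -> 'rV[R]_Neq)
    (Uh_in : forall k x (t : R), Omega_hat E x -> 0 < t < T ->
       Upsilon (Uh u k x t))
    (Uext_in : forall q (i : 'I_(Nq S q.2)) (t : R), 0 < t < T ->
       Upsilon (Uext q i t))
    (rank_V : \rank (Vmx S) = Np S)
    (W_spd : spd (Wv S))
    (Wf_spd : forall g, spd (Wf S g))
    (Mk_inv : forall k : 'I_(nelt Me), Mkmx S k \in unitmx)
    (Ms_sub : (Ms `<=` calN S)%fset)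
    (KD0 : forall m : 'I_d, Kmx S Ms C *m Dmx S m = 0)
    (MK_spd : spd (Mmx S + Kmx S Ms C))
    (const_in : forall c : R, poly_space (calN S) (fun _ => c))
    (method : dg_method F Fstar u Uext (fun k => Mkmx S k) T \/
       (((forall a, a \in calN S -> a = [ffun=> 0%N]) -> Kmx S Ms C = 0) /\
        dg_method F Fstar u Uext
          (fun k => Mkmx S k *m invmx (Fkmx S Ms C k)) T)) :
  locally_conservative Fstar u Uext T /\
  ((forall U V n, Upsilon U -> Upsilon V -> sphere n ->
      Fstar U V n = - Fstar V U (- n)) ->
   forall Cf : conformity S Me,
   (forall q (qK : q \in Kint Me) (i : 'I_(Nq S q.2)) (t : R), 0 < t < T ->
      Uext q i t = Uh u (nbr Cf q).1 (xf (nbr_node Cf qK i)) t) ->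
   globally_conservative Fstar u Uext T).
Proof.
have [b b1] := represents_exists (const_in 1).
have uM := Mmx_unit rank_V W_spd.
have local : locally_conservative Fstar u Uext T.
  case: method => [|[trivialK]].
    exact: (dg_locally_conservative (b := b)).
  apply: (dg_locally_conservative b1) => k.
  rewrite filtered_mass //; last exact: spd_unitmx.
  have bK : b^T *m Kmx S Ms C = 0.
    rewrite -(Kmx_sym Ms C W_spd.1) -trmx_mul.
    by rewrite (Kmx_represents_cst KD0 trivialK b1) trmx0.
  by rewrite mulmxDr mulmxA bK mul0mx addr0.
split=> // Fstar_anti Cf Uext_nbr.
exact: (globally_conservative_of_locally Uh_in Uext_in Fstar_anti Uext_nbr).
Qed.
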